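(* Let $(R,\mathfrak{m})$ be a Cohen-Macaulay local ring of dimension one with infinite residue field, and let $I \subset R$ be an $\mathfrak{m}$-primary ideal with integral closure $\bar{I}$. Let $k\ge 1$ be an integer and suppose that there exist distinct integrally closed ideals $J_1,\dots,J_{k-1}$ of $R$ such that $$\mathfrak{m} \supsetneq J_{k-1} \supseteq J_{k-2} \supseteq \cdots \supseteq J_{1} \supsetneq \bar{I}.$$ Then $$e_1(I) \le \binom{e_0(I)-k}{2}.$$ Moreover, if $I$ is not integrally closed, then $e_1(I) < \binom{e_0(I)-k}{2}$.
   Context: Rings are commutative and Noetherian. $\lambda(\cdot)$ denotes length of an $R$-module. For an $\mathfrak{m}$-primary ideal $I$ in a one-dimensional Cohen-Macaulay local ring $(R,\mathfrak m)$, the Hilbert coefficients $e_0(I), e_1(I)$ are the integers such that $\lambda(R/I^{n+1}) = e_0(I)(n+1) - e_1(I)$ for all large $n$. When $k=1$ there are no ideals $J_i$ and the chain condition is read as $\mathfrak m \supsetneq \bar I$. *)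

(* Defs.v *)
From HB Require Import structures.
From mathcomp Require Import all_boot all_order all_algebra.
From mathcomp Require Import boolp classical_sets cardinality.

Set Implicit Arguments.
Unset Strict Implicit.
Unset Printing Implicit Defensive.

Import Order.TTheory GRing.Theory Num.Theory.
Local Open Scope classical_set_scope.
Local Open Scope ring_scope.

Identity Coercion fun_of_set : set >-> Funclass.

Definition is_submodule (R : comNzRingType) (M : lmodType R) (A : set M) :=
  A 0 /\ forall (a : R) (x y : M), A x -> A y -> A (a *: x + y).

Record submodule (R : comNzRingType) (M : lmodType R) := Submodule {
  submodule_set :> set M;
  submoduleP : is_submodule submodule_set
}.

(* Ideals need not be proper, unlike the predicates [idealr] of MathComp. *)
Notation ideal R := (submodule (GRing.regular R)).

Section QuotientModule.
Variables (R : comNzRingType) (M : lmodType R) (N : submodule M).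

Definition submodule_pred : M -> bool := fun x => `[< N x >].

Lemma submodule_pred_closed : GRing.submod_closed submodule_pred.
Proof.
have [N0 NP] := submoduleP N; split; first exact/asboolP.
by move=> a x y /asboolP Nx /asboolP Ny; apply/asboolP/NP.
Qed.

HB.instance Definition _ :=
  GRing.isSubmodClosed.Build R M submodule_pred submodule_pred_closed.

Local Notation NZ := (GRing.ZmodClosed.clone M submodule_pred _).

Definition quotmod := Quotient.quot NZ.

HB.instance Definition _ := GRing.Zmodule.on quotmod.

Local Notation pi := (\pi_(Quotient.quot NZ))%qT.

Lemma pi_eqP (x y : M) : reflect (pi x = pi y) (x - y \in submodule_pred).
Proof.
apply: (iffP idP) => [h|h].
  by apply/eqP; rewrite -(Quotient.idealrBE NZ).
by rewrite (Quotient.idealrBE NZ); apply/eqP.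
Qed.

Lemma pi_addE (x y : M) : (pi x : quotmod) + (pi y : quotmod) = pi (x + y).
Proof. exact: esym (Quotient.pi_add NZ x y). Qed.

Definition quotmod_scale (a : R) (x : quotmod) : quotmod :=
  pi (a *: generic_quotient.repr x).

Lemma quotmod_scale_pi a x : quotmod_scale a (pi x) = pi (a *: x).
Proof.
apply/pi_eqP; rewrite -scalerBr rpredZ //; apply/pi_eqP.
exact: generic_quotient.reprK.
Qed.

Lemma pi_surj (v : quotmod) : exists x, v = pi x.
Proof. by exists (generic_quotient.repr v); rewrite generic_quotient.reprK. Qed.

Lemma quotmod_scaleA a b v :
  quotmod_scale a (quotmod_scale b v) = quotmod_scale (a * b) v.
Proof.
by have [x ->] := pi_surj v; rewrite !quotmod_scale_pi scalerA.
Qed.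

Lemma quotmod_scale1 : left_id 1 quotmod_scale.
Proof.
by move=> v; have [x ->] := pi_surj v; rewrite quotmod_scale_pi scale1r.
Qed.

Lemma quotmod_scaleDr : right_distributive quotmod_scale +%R.
Proof.
move=> a u v; have [x ->] := pi_surj u; have [y ->] := pi_surj v.
by rewrite pi_addE !quotmod_scale_pi pi_addE scalerDr.
Qed.

Lemma quotmod_scaleDl v : {morph quotmod_scale^~ v : a b / a + b}.
Proof.
move=> a b; have [x ->] := pi_surj v.
by rewrite !quotmod_scale_pi pi_addE scalerDl.
Qed.

HB.instance Definition _ := GRing.Zmodule_isLmodule.Build R quotmod
  quotmod_scaleA quotmod_scale1 quotmod_scaleDr quotmod_scaleDl.

End QuotientModule.

Definition has_length (R : comNzRingType) (M : lmodType R) (l : nat) :=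
  let chain n := exists N : nat -> submodule M,
    forall i, (i < n)%N -> N i `<` N i.+1 in
  chain l /\ forall n, chain n -> (n <= l)%N.

Section Ideals.
Variable R : comNzRingType.
Implicit Types (I J P m : ideal R).

Lemma ideal_gen_subproof (S : set R) :
  @is_submodule R R^o [set x | forall J, S `<=` J -> J x].
Proof.
split=> [J _|a x y hx hy J SJ]; first by case: (submoduleP J).
by case: (submoduleP J) => _; apply; [exact: hx|exact: hy].
Qed.

Definition ideal_gen (S : set R) : ideal R := Submodule (ideal_gen_subproof S).

Definition ideal_mul I J : ideal R :=
  ideal_gen [set a * b | a in (I : set R) & b in (J : set R)].

Definition ideal_exp I (n : nat) : ideal R :=
  iter n (ideal_mul I) (ideal_gen [set 1]).

Definition radical I : set R := [set x | exists n, I (x ^+ n)].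

Definition prime_ideal P :=
  ~ P 1 /\ forall x y : R, P (x * y) -> P x \/ P y.

Definition primary_ideal I :=
  ~ I 1 /\ forall x y : R, I (x * y) -> I x \/ radical I y.

Definition primary_to P I := primary_ideal I /\ radical I = P.

Definition maximal_ideal m :=
  ~ m 1 /\ forall J, ~ J 1 -> m `<=` J -> J = m :> set R.

Definition local_ring m :=
  maximal_ideal m /\ forall n : ideal R, maximal_ideal n -> n = m :> set R.

Definition krull_dim (d : nat) :=
  let chain n := exists P : nat -> ideal R,
    (forall i, (i <= n)%N -> prime_ideal (P i)) /\
    (forall i, (i < n)%N -> P i `<` P i.+1) in
  chain d /\ forall n, chain n -> (n <= d)%N.

(* For a sequence in the maximal ideal [m] of a local ring, R / (s) <> 0 holds
   automatically, so that only the nonzerodivisor condition remains. *)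
Definition regular_sequence m (s : seq R) :=
  (forall x, x \in s -> m x) /\
  forall i, (i < size s)%N -> forall a : R,
    ideal_gen [set` take i s] (a * s`_i) -> ideal_gen [set` take i s] a.

Definition local_depth m (d : nat) :=
  (exists2 s, regular_sequence m s & size s = d) /\
  forall s, regular_sequence m s -> (size s <= d)%N.

Definition integral_closure I : set R :=
  [set x | exists (n : nat) (a : nat -> R),
    [/\ (0 < n)%N,
        forall i, (1 <= i <= n)%N -> ideal_exp I i (a i) &
        x ^+ n + \sum_(1 <= i < n.+1) a i * x ^+ (n - i) = 0]].

Definition integrally_closed I := integral_closure I = I.

(* Specific to dimension one, where the Hilbert polynomial has only these two
   coefficients. *)
Definition hilbert_coeffs I (e0 e1 : int) :=
  exists N : nat, forall n : nat, (N <= n)%N ->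
    exists2 l : nat, has_length (quotmod (ideal_exp I n.+1)) l &
      l%:Z = e0 * n.+1%:Z - e1.

End Ideals.

Definition noetherian (R : comNzRingType) :=
  forall I : ideal R, exists s : seq R, I = ideal_gen [set` s] :> set R.

Definition cohen_macaulay (R : comNzRingType) (m : ideal R) :=
  exists2 d, krull_dim R d & local_depth m d.

(* The binomial coefficient "z choose 2" for an arbitrary integer z; the
   division is exact. *)
Definition binz2 (z : int) : int := ((z * (z - 1)) %/ 2)%Z.

(* Main.v *)
Require Import Defs.
From HB Require Import structures.
From mathcomp Require Import all_boot all_order all_algebra.
From mathcomp Require Import perm.
From mathcomp Require Import boolp classical_sets functions cardinality.
From mathcomp Require Import zify ring.

Set Implicit Arguments.
Unset Strict Implicit.
Unset Printing Implicit Defensive.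

Import Order.TTheory GRing.Theory Num.Theory.
Local Open Scope classical_set_scope.
Local Open Scope ring_scope.

(* The lengths h_i of I^i / I^(i+1) satisfy e1 = sum_i (e0 - h_i), so it is
   enough that h_i >= min (e0, i + k + 1), with h_0 >= k + 2 when I is not
   integrally closed. If I^i needs at most i generators, then I^i = l I^(i-1)
   for some l in I (Eakin-Sathaye), so h is nonincreasing from i - 1 on, and
   h_i >= e0, its eventual value. Otherwise I^i / m I^i has length at least
   i + 1, while m I^i > J_(k-1) I^i > ... > J_1 I^i > I^(i+1) is strict by the
   determinant trick, because I^i contains a nonzerodivisor. *)

(** Each term satisfies e0 - h_i <= max (0, e0 - k - 1 - i), and the positive bounds run through e0
    - k - 1, e0 - k - 2, ..., 1, with sum at most the binomial coefficient. One more unit of length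
    in h_0 lowers the first term by one, which gives strictness. Lengths are handled through chains:
    [has_chain] asserts a length of at least n, an upper bound is the failure of a chain, and exact
    lengths enter only through [hilbert_coeffs]. The element l is found on a moment curve:
    parameters with distinct residues give combinations of the r generators of I such that any r of
    them span I by Vandermonde, so a generic choice means all large indices instead of a Zariski
    open set. *)

Section IdealOperations.
Variable R : comNzRingType.
Implicit Types (A B C I J K L M N U m : ideal R) (a b c x y : R).

Lemma ideal_zero A : A 0.
Proof. by case: (submoduleP A). Qed.

Lemma ideal_mulr A a x : A x -> A (a * x).
Proof.
move=> Ax; have [A0 AP] := submoduleP A.
by have := AP a x 0 Ax A0; rewrite addr0.
Qed.

Lemma ideal_mull A a x : A x -> A (x * a).
Proof. by rewrite mulrC; exact: ideal_mulr. Qed.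

Lemma ideal_add A x y : A x -> A y -> A (x + y).
Proof.
move=> Ax Ay; have [_ AP] := submoduleP A.
by have := AP 1 x y Ax Ay; rewrite scale1r.
Qed.

Lemma ideal_opp A x : A x -> A (- x).
Proof. by rewrite -mulN1r; exact: ideal_mulr. Qed.

Lemma ideal_sub A x y : A x -> A y -> A (x - y).
Proof. by move=> Ax Ay; apply: ideal_add => //; exact: ideal_opp. Qed.

Lemma ideal_sum A (T : Type) (r : seq T) (P : pred T) (F : T -> R) :
  (forall i, P i -> A (F i)) -> A (\sum_(i <- r | P i) F i).
Proof.
by move=> AF; apply: big_ind => //; [exact: ideal_zero|exact: ideal_add].
Qed.

Lemma ideal_gen_mem (S : set R) x : S x -> ideal_gen S x.
Proof. by move=> Sx J; apply. Qed.

Lemma ideal_gen_sub (S : set R) A : S `<=` A -> ideal_gen S `<=` A.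
Proof. by move=> SA x; apply. Qed.

Lemma is_ideal (P : set R) : P 0 -> (forall x y, P x -> P y -> P (x + y)) ->
  (forall a x, P x -> P (a * x)) -> @is_submodule R R^o P.
Proof. by move=> P0 PD PM; split=> // a x y Px Py; exact: PD (PM a x Px) Py. Qed.

Definition idealT : ideal R :=
  Submodule (@is_ideal setT I (fun _ _ _ _ => I) (fun _ _ _ => I)).

Lemma idealD_subproof A B :
  @is_submodule R R^o [set z | exists x y, [/\ A x, B y & z = x + y]].
Proof.
apply: is_ideal.
- by exists 0, 0; rewrite addr0; split=> //; exact: ideal_zero.
- move=> _ _ [x [y [Ax By ->]]] [x' [y' [Ax' By' ->]]].
  by exists (x + x'), (y + y'); rewrite addrACA; split=> //; exact: ideal_add.
- move=> a _ [x [y [Ax By ->]]].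
  by exists (a * x), (a * y); rewrite mulrDr; split=> //; exact: ideal_mulr.
Qed.

Definition idealD A B : ideal R := Submodule (idealD_subproof A B).

Lemma idealDl A B : A `<=` idealD A B.
Proof. by move=> x Ax; exists x, 0; rewrite addr0; split=> //; exact: ideal_zero. Qed.

Lemma idealDr A B : B `<=` idealD A B.
Proof. by move=> x Ax; exists 0, x; rewrite add0r; split=> //; exact: ideal_zero. Qed.

Lemma idealD_sub A B C : A `<=` C -> B `<=` C -> idealD A B `<=` C.
Proof. by move=> AC BC _ [x [y [/AC Cx /BC Cy ->]]]; exact: ideal_add. Qed.

Lemma idealI_subproof A B : @is_submodule R R^o (A `&` B).
Proof.
apply: is_ideal => [|x y [? ?] [? ?]|a x [? ?]].
- by split; exact: ideal_zero.
- by split; exact: ideal_add.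
- by split; exact: ideal_mulr.
Qed.

Definition idealI A B : ideal R := Submodule (idealI_subproof A B).

Lemma idealZ_subproof (l : R) A :
  @is_submodule R R^o [set z | exists2 x, A x & z = l * x].
Proof.
apply: is_ideal => [|_ _ [x Ax ->] [y Ay ->]|a _ [x Ax ->]].
- by exists 0; [exact: ideal_zero|rewrite mulr0].
- by exists (x + y); [exact: ideal_add|rewrite mulrDr].
- by exists (a * x); [exact: ideal_mulr|rewrite mulrCA].
Qed.

Definition idealZ l A : ideal R := Submodule (idealZ_subproof l A).

Lemma colon_subproof (S : set R) A :
  @is_submodule R R^o [set x | forall s, S s -> A (x * s)].
Proof.
apply: is_ideal => [s _|x y Ax Ay s Ss|a x Ax s Ss].
- by rewrite mul0r; exact: ideal_zero.
- by rewrite mulrDl; apply: ideal_add; [exact: Ax|exact: Ay].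
- by rewrite -mulrA; apply: ideal_mulr; exact: Ax.
Qed.

(** Containment in a colon ideal lets a claim about multiples of all elements of a product ideal be
    checked on the products [a * b] that generate it. *)
Definition colon A (S : set R) : ideal R := Submodule (colon_subproof S A).

Lemma ideal_mul_mem A B a b : A a -> B b -> ideal_mul A B (a * b).
Proof. by move=> Aa Bb; apply: ideal_gen_mem; exists a => //; exists b. Qed.

Lemma ideal_mul_sub A B C :
  (forall a b, A a -> B b -> C (a * b)) -> ideal_mul A B `<=` C.
Proof. by move=> ABC; apply: ideal_gen_sub => _ [a Aa [b Bb <-]]; exact: ABC. Qed.

Lemma ideal_mul_subl A B : ideal_mul A B `<=` A.
Proof. by apply: ideal_mul_sub => a b Aa _; exact: ideal_mull. Qed.

Lemma ideal_mul_subr A B : ideal_mul A B `<=` B.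
Proof. by apply: ideal_mul_sub => a b _; exact: ideal_mulr. Qed.

Lemma ideal_mulS A A' B B' :
  A `<=` A' -> B `<=` B' -> ideal_mul A B `<=` ideal_mul A' B'.
Proof.
move=> AA BB; apply: ideal_mul_sub => a b Aa Bb.
by apply: ideal_mul_mem; [exact: AA|exact: BB].
Qed.

Lemma ideal_exp0 A x : ideal_exp A 0 x.
Proof. by rewrite -[x]mulr1; apply/ideal_mulr/ideal_gen_mem. Qed.

Lemma ideal_exp_decr A n : ideal_exp A n.+1 `<=` ideal_exp A n.
Proof. exact: ideal_mul_subr. Qed.

Lemma ideal_exp_anti A n p : (n <= p)%N -> ideal_exp A p `<=` ideal_exp A n.
Proof.
move=> /subnK <-; elim: (p - n)%N => [//|q IH].
by apply: subset_trans IH; exact: ideal_exp_decr.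
Qed.

Lemma ideal_exp_mul A n p x y :
  ideal_exp A n x -> ideal_exp A p y -> ideal_exp A (n + p) (x * y).
Proof.
elim: n x => [|n IH] x; first by move=> _; exact: ideal_mulr.
move=> Ax Ay; suff: ideal_exp A n.+1 `<=` colon (ideal_exp A (n.+1 + p)) [set y].
  by move=> /(_ x Ax); apply.
apply: ideal_mul_sub => a b Aa Ab s ->; rewrite -mulrA addSn.
by apply: ideal_mul_mem => //; exact: IH.
Qed.

Lemma ideal_exp_pow A x n : A x -> ideal_exp A n (x ^+ n).
Proof.
move=> Ax; elim: n => [|n IH]; first exact: ideal_exp0.
by rewrite exprS; apply: ideal_mul_mem.
Qed.

Lemma ideal_expS A B n : A `<=` B -> ideal_exp A n `<=` ideal_exp B n.
Proof. by move=> AB; elim: n => [//|n IH]; exact: ideal_mulS. Qed.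

Lemma lin_comb_subproof A (g : seq R) : @is_submodule R R^o
  [set x | exists2 c : 'I_(size g) -> R,
     forall i, A (c i) & x = \sum_i c i * g`_i].
Proof.
apply: is_ideal => [|_ _ [c Ac ->] [d Ad ->]|a _ [c Ac ->]].
- exists (fun=> 0) => [i|]; first exact: ideal_zero.
  by rewrite big1 // => i _; rewrite mul0r.
- exists (fun i => c i + d i) => [i|]; first exact: ideal_add.
  by rewrite -big_split; apply: eq_bigr => i _; rewrite mulrDl.
- exists (fun i => a * c i) => [i|]; first exact: ideal_mulr.
  by rewrite big_distrr; apply: eq_bigr => i _; rewrite /= mulrA.
Qed.

Lemma ideal_gen_seqP (g : seq R) x : ideal_gen [set` g] x ->
  exists c : 'I_(size g) -> R, x = \sum_i c i * g`_i.
Proof.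
move=> gx; suff: Submodule (lin_comb_subproof idealT g) x.
  by case=> c _ ->; exists c.
apply: gx => z /= zg; have iz : (index z g < size g)%N by rewrite index_mem.
exists (fun i => (i == Ordinal iz)%:R) => //.
rewrite (bigD1 (Ordinal iz)) //= eqxx mul1r nth_index // big1 ?addr0 // => i.
by move=> /negbTE ->; rewrite mul0r.
Qed.

Lemma ideal_mul_genP A M (g : seq R) x : M = ideal_gen [set` g] :> set R ->
  ideal_mul A M x ->
  exists2 c : 'I_(size g) -> R, forall i, A (c i) & x = \sum_i c i * g`_i.
Proof.
move=> Mg Ax; suff: Submodule (lin_comb_subproof A g) x by [].
move: x Ax; apply: ideal_mul_sub => a b Aa; rewrite Mg => /ideal_gen_seqP[c ->].
exists (fun i => a * c i) => [i|]; first exact: ideal_mull.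
by rewrite big_distrr; apply: eq_bigr => i _; rewrite /= mulrA.
Qed.

Lemma gen_nth_mem M (g : seq R) (i : 'I_(size g)) :
  M = ideal_gen [set` g] :> set R -> M g`_i.
Proof. by move=> ->; apply: ideal_gen_mem => /=; exact: mem_nth. Qed.

End IdealOperations.

Lemma regular_exp (R : comNzRingType) (x : R) n :
  (forall a : R, a * x = 0 -> a = 0) -> forall a : R, a * x ^+ n = 0 -> a = 0.
Proof.
move=> xreg; elim: n => [|n IH] a; first by rewrite expr0 mulr1.
by rewrite exprSr mulrA => /xreg /IH.
Qed.

(** * Determinant trick, integral dependence and Nakayama *)

Section CayleyHamilton.
Variable R : comNzRingType.
Implicit Types (I J M C m : ideal R).

(* The polynomials [p] for which [Y ^ d * p (X / Y)] has its coefficient of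
   [Y ^ i] in [J ^ i]. *)
Definition rees_homog J d (p : {poly R}) : Prop :=
  forall j, ideal_exp J (d - j) p`_j.

Lemma rees_homogM J d e p q :
  rees_homog J d p -> rees_homog J e q -> rees_homog J (d + e) (p * q).
Proof.
move=> Jp Jq j; rewrite coefM; apply: ideal_sum => i _.
(* Truncated subtraction only makes [(d - i) + (e - (j - i))] at least [d + e - j], which suffices
   since powers decrease. *)
apply: ideal_exp_anti (ideal_exp_mul (Jp i) (Jq (j - i)%N)).
by have := ltn_ord i; lia.
Qed.

Lemma rees_homog_prod J (T : Type) (r : seq T) (F : T -> {poly R}) :
  (forall i, rees_homog J 1 (F i)) -> rees_homog J (size r) (\prod_(i <- r) F i).
Proof.
move=> JF; elim: r => [|i r IH] /=; first by move=> j; exact: ideal_exp0.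
by rewrite big_cons; exact: rees_homogM (JF i) IH.
Qed.

Lemma rees_homog_char_poly J n (A : 'M[R]_n) :
  (forall i j, J (A i j)) -> rees_homog J n (char_poly A).
Proof.
move=> JA; rewrite /char_poly /determinant => j.
rewrite coef_sum; apply: ideal_sum => s _.
have Js : rees_homog J n (\prod_i char_poly_mx A i (s i)).
  have := @rees_homog_prod J _ (index_enum 'I_n)
    (fun i => char_poly_mx A i (s i)).
  rewrite /index_enum -enumT size_enum_ord => /(_ _); apply=> i [|l].
    rewrite /char_poly_mx !mxE coefB coefMn coefX coefC mul0rn sub0r.
    apply: ideal_opp; rewrite -[X in ideal_exp _ _ X]mulr1.
    by apply: ideal_mul_mem => //; exact: ideal_exp0.
  by apply: ideal_exp_anti (ideal_exp0 J _).
by case: (perm.odd_perm s); rewrite ?expr1 ?expr0 ?mulN1r ?mul1r;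
  rewrite ?coefN; first apply: ideal_opp; exact: Js.
Qed.

(* The adjugate of [y - A] turns the relations [y g_i - sum_j A_ij g_j \in C]
   into [det (y - A) g_j \in C]. *)
Lemma det_trick M C J (g : seq R) (y : R) : M = ideal_gen [set` g] :> set R ->
  (forall x : R, M x -> idealD (ideal_mul J M) C (y * x)) ->
  exists2 A : 'M[R]_(size g), forall i j, J (A i j) &
    forall x : R, M x -> C ((char_poly A).[y] * x).
Proof.
move=> Mg yM.
have /choice[c cP] (i : 'I_(size g)) : exists c : 'I_(size g) -> R,
    (forall j, J (c j)) /\ C (y * g`_i - \sum_j c j * g`_j).
  have [u [v [Ju Cv ->]]] := yM _ (gen_nth_mem i Mg).
  have [c Jc ->] := ideal_mul_genP Mg Ju.
  by exists c; split=> //; rewrite addrAC subrr add0r.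
pose A := \matrix_(i, j) c i j; exists A => [i j|x].
  by rewrite mxE; case: (cP i).
have detE : (char_poly A).[y] = \det (y%:M - A).
  rewrite /char_poly -horner_evalE -det_map_mx; congr (\det _).
  apply/matrixP => i j.
  rewrite /char_poly_mx !mxE -[LHS]/(_.[y]).
  by rewrite hornerD hornerN hornerMn hornerX hornerC.
rewrite Mg => /ideal_gen_seqP[d ->]; rewrite big_distrr; apply: ideal_sum => i _.
rewrite /= mulrCA; apply: ideal_mulr; rewrite detE.
pose G : 'cV[R]_(size g) := \col_j g`_j.
have -> : \det (y%:M - A) * g`_i =
    (\adj (y%:M - A) *m ((y%:M - A) *m G)) i 0.
  by rewrite mulmxA mul_adj_mx mul_scalar_mx !mxE.
rewrite mxE; apply: ideal_sum => j _; apply: ideal_mulr.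
rewrite mulmxBl mul_scalar_mx !mxE.
under eq_bigr do rewrite !mxE.
by case: (cP j).
Qed.

(** Determinant trick modulo the zero ideal: the value of the characteristic polynomial at [y] kills
    the nonzerodivisor [x], hence vanishes, and [rees_homog] puts the coefficients in the required
    powers of [J]. *)
Lemma integral_of_mul J M (x y : R) : noetherian R ->
  M x -> (forall a : R, a * x = 0 -> a = 0) ->
  (forall z : R, M z -> ideal_mul J M (y * z)) -> integral_closure J y.
Proof.
move=> noeth Mx xreg yM; have [g Mg] := noeth M.
pose O : ideal R := idealZ 0 (idealT R).
have OE a : O a -> a = 0 by case=> b _ ->; rewrite mul0r.
have [|A JA AM] := @det_trick M O J g y Mg.
  by move=> z Mz; apply: idealDl; exact: yM.
have Ay : (char_poly A).[y] = 0 by apply: xreg; apply: OE; exact: AM.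
have lcA : (char_poly A)`_(size g) = 1.
  by have /monicP := char_poly_monic A; rewrite lead_coefE size_char_poly.
exists (size g), (fun i => (char_poly A)`_(size g - i)%N); split.
(* With no generators the characteristic polynomial is 1, and its vanishing at [y] would give 1 =
   0. *)
- rewrite lt0n; apply/eqP => g0; move: Ay; rewrite horner_coef size_char_poly.
  move: lcA; move: (char_poly A) => p; rewrite g0 big_ord1 => ->.
  by rewrite mul1r expr0 => /eqP; rewrite oner_eq0.
- move=> i /andP[_ ig]; have := rees_homog_char_poly JA (size g - i)%N.
  by rewrite subKn.
- rewrite -[RHS]Ay horner_coef size_char_poly big_ord_recr /= lcA mul1r addrC.
  congr (_ + _); rewrite big_add1 /= big_mkord (reindex_inj rev_ord_inj) /=.
  apply: eq_bigr => i _; have ilt := ltn_ord i.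
  by congr (_`_ _ * _ ^+ _); lia.
Qed.

(** Determinant trick for [y = 1]: all coefficients of the characteristic polynomial but the leading
    one lie in [m], so its value at 1 is a unit that multiplies [M] into [C]. *)
Lemma nakayama m M C : noetherian R ->
  (forall a : R, m a -> exists b : R, (1 + a) * b = 1) ->
  M `<=` idealD C (ideal_mul m M) -> M `<=` C.
Proof.
move=> noeth mU MC; have [g Mg] := noeth M.
have [|A JA AM] := @det_trick M C m g 1 Mg.
  by move=> x /MC [u [v [Cu mv ->]]]; exists v, u; rewrite mul1r addrC.
have [a ma Aa] : exists2 a, m a & (char_poly A).[1] = 1 + a.
  rewrite horner_coef size_char_poly big_ord_recr /=.
  have /monicP := char_poly_monic A; rewrite lead_coefE size_char_poly /= => ->.
  rewrite expr1n mulr1 addrC.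
  exists (\sum_(i < size g) (char_poly A)`_i * 1 ^+ i) => //.
  apply: ideal_sum => i _; apply: ideal_mull.
  apply: (@ideal_mul_subl _ m (ideal_exp m 0)).
  by apply: (@ideal_exp_anti _ m 1) (rees_homog_char_poly JA i); rewrite subn_gt0.
have [b ab1] := mU a ma; move=> x Mx.
by rewrite -[x]mul1r -ab1 [_ * b]mulrC -mulrA -Aa; apply: ideal_mulr; exact: AM.
Qed.

End CayleyHamilton.

(** * Chains of ideals as lower bounds on length *)

Section Chains.
Variable R : comNzRingType.
Implicit Types (A B C D I J K L M N U m : ideal R).

(** This says that [A / B] has length at least [n], with no finiteness assumed. The end terms need
    not be [B] and [A], which makes chains easy to widen and to shorten. *)
Definition has_chain B A n := exists N : nat -> ideal R,
  [/\ B `<=` N 0%N, forall i, (i < n)%N -> N i `<` N i.+1 & N n `<=` A].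

Lemma chain_mono (N : nat -> ideal R) n i j :
  (forall i, (i < n)%N -> N i `<` N i.+1) -> (i <= j)%N -> (j <= n)%N ->
  N i `<=` N j.
Proof.
move=> NP /subnK <-; elim: (j - i)%N => [_ x //|d IH dn].
by apply: subset_trans (IH (ltnW dn)) _; case: (NP _ dn).
Qed.

Lemma has_chain0 B A : B `<=` A -> has_chain B A 0.
Proof. by move=> BA; exists (fun=> B); split. Qed.

Lemma has_chainS B A A' n :
  has_chain B A n -> A `<` A' -> has_chain B A' n.+1.
Proof.
move=> [N [BN NP NA]] [AA' A'A]; exists (fun i => if (i <= n)%N then N i else A').
split=> [//|i|]; last by rewrite ltnn.
rewrite ltnS => ilen; rewrite ilen; case: ltnP => [|ni]; first exact: NP.
have -> : i = n by apply/eqP; rewrite eqn_leq ilen.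
split; first by apply: subset_trans AA'.
by move=> A'N; apply: A'A; apply: subset_trans NA.
Qed.

Lemma has_chain_cat B C A n p :
  has_chain B C n -> has_chain C A p -> has_chain B A (n + p).
Proof.
move=> BC [N [CN NP NA]]; have: forall i, (i <= p)%N -> has_chain B (N i) (n + i).
  elim=> [_|i IH ip]; last first.
    by rewrite addnS; apply: (has_chainS (IH (ltnW ip)) (NP _ ip)).
  rewrite addn0; case: BC => N' [BN' NP' NC]; exists N'; split=> //.
  exact: subset_trans CN.
move=> /(_ _ (leqnn p)) [N' [? ? N'A]]; exists N'; split=> //.
exact: subset_trans NA.
Qed.

Lemma has_chain_le B A n p : (p <= n)%N -> has_chain B A n -> has_chain B A p.
Proof.
move=> pn [N [BN NP NA]]; exists N; split=> // [i ip|]; first by apply: NP; lia.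
have Npn := chain_mono NP pn (leqnn n).
by move=> x /Npn /NA.
Qed.

Lemma has_chainW B B' A A' n :
  B' `<=` B -> A `<=` A' -> has_chain B A n -> has_chain B' A' n.
Proof.
move=> BB AA [N [BN NP NA]]; exists N; split=> //.
  exact: subset_trans BN.
exact: subset_trans AA.
Qed.

Lemma has_chain1 B A : B `<` A -> has_chain B A 1.
Proof. by apply: has_chainS; exact: has_chain0. Qed.

(* By the modular law each strict step stays strict after intersecting with [B]
   or after adding [B]. *)
Lemma has_chain_split C B A n : C `<=` B -> B `<=` A -> has_chain C A n ->
  exists p q, [/\ n = (p + q)%N, has_chain C B p & has_chain B A q].
Proof.
move=> CB BA [N [CN NP NA]].
have : forall i, (i <= n)%N -> exists p q, [/\ i = (p + q)%N,
    has_chain C (idealI (N i) B) p & has_chain B (idealD (N i) B) q].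
  elim=> [_|i IH ilt].
    exists 0%N, 0%N; split=> //; apply: has_chain0; last exact: idealDr.
    by move=> x Cx; split; [exact: CN|exact: CB].
  have [p [q [ipq Cp Bq]]] := IH (ltnW ilt); have [NN NNn] := NP _ ilt.
  have I_le : idealI (N i) B `<=` idealI (N i.+1) B.
    by move=> x [/NN ? ?].
  have D_le : idealD (N i) B `<=` idealD (N i.+1) B.
    by apply: idealD_sub (@idealDr _ _ _); apply: subset_trans (@idealDl _ _ _).
  have [II|II] := pselect (idealI (N i.+1) B `<=` idealI (N i) B); last first.
    exists p.+1, q; split; first by rewrite ipq.
      exact: has_chainS Cp _.
    exact: has_chainW D_le Bq.
  exists p, q.+1; split; first by rewrite ipq addnS.
    exact: has_chainW I_le Cp.
  apply: has_chainS Bq _; split=> // DD; apply: NNn => x Nx.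
  (* Here [b = x - y] lies in both [N i.+1] and [B], hence in [N i], and then so does [x]. *)
  have [y [b [Ny Bb xyb]]] := DD _ (@idealDl _ _ B _ Nx).
  have [|Nb _] := II b; first split=> //.
    by have := ideal_sub Nx (NN _ Ny); rewrite xyb addrAC subrr add0r.
  by rewrite xyb; exact: ideal_add.
move=> /(_ _ (leqnn n)) [p [q [npq Cp Bq]]]; exists p, q; split=> //.
  by apply: has_chainW Cp => // x [].
by apply: has_chainW Bq => //; exact: idealD_sub.
Qed.

End Chains.

(** * Correspondence between submodules of R / B and ideals above B *)

Section QuotientLength.
Variables (R : comNzRingType) (B : ideal R).

Definition quot_pi (x : R) : quotmod B := (\pi_(Quotient.quot
  (GRing.ZmodClosed.clone _ (submodule_pred B) _)))%qT x.

Lemma quot_piE (x y : R) : quot_pi x = quot_pi y <-> B (x - y).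
Proof.
split; first by move/(pi_eqP B)/asboolP.
by move=> Bxy; apply/(pi_eqP B)/asboolP.
Qed.

Lemma quot_piD (x y : R) : quot_pi (x + y) = quot_pi x + quot_pi y.
Proof. exact: esym (pi_addE B x y). Qed.

Lemma quot_piZ (a x : R) : quot_pi (a * x) = a *: quot_pi x.
Proof. exact: esym (quotmod_scale_pi B a x). Qed.

Lemma quot_pi0 : quot_pi 0 = 0.
Proof. by rewrite -(mul0r 0) quot_piZ scale0r. Qed.

Lemma quot_pi_ker (x : R) : B x -> quot_pi x = 0.
Proof. by move=> Bx; rewrite -quot_pi0; apply/quot_piE; rewrite subr0. Qed.

Lemma quot_pi_surj (v : quotmod B) : exists x : R, v = quot_pi x.
Proof. by have [x ->] := pi_surj v; exists x. Qed.

Lemma quot_preim_subproof (N : submodule (quotmod B)) :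
  @is_submodule R R^o (quot_pi @^-1` N).
Proof.
have [N0 NP] := submoduleP N; split=> [|a x y Nx Ny] /=; first by rewrite quot_pi0.
by rewrite -[a *: x]/(a * x) quot_piD quot_piZ; exact: NP.
Qed.

Definition quot_preim N : ideal R := Submodule (quot_preim_subproof N).

Lemma quot_im_subproof (A : ideal R) : is_submodule (quot_pi @` A).
Proof.
split; first by exists 0; [exact: ideal_zero|exact: quot_pi0].
move=> a _ _ [x Ax <-] [y Ay <-]; exists (a * x + y).
  by apply: ideal_add => //; exact: ideal_mulr.
by rewrite quot_piD quot_piZ.
Qed.

Definition quot_im A : submodule (quotmod B) := Submodule (quot_im_subproof A).

Lemma has_length_chain n : has_length (quotmod B) n ->
  has_chain B (idealT R) n /\ forall p, has_chain B (idealT R) p -> (p <= n)%N.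
Proof.
move=> [[N NP] nmax]; split.
  exists (fun i => quot_preim (N i)); split=> // [x Bx|i /NP[NN NNn]].
    by rewrite /= quot_pi_ker //; case: (submoduleP (N 0%N)).
  split=> [x /NN //|NNp]; apply: NNn => v; have [x ->] := quot_pi_surj v.
  exact: NNp.
move=> p [M [BM MP _]]; apply: nmax; exists (fun i => quot_im (M i)) => i ip.
have [MM MMn] := MP i ip; split=> [_ [x /MM Mx <-]|MMp]; first by exists x.
apply: MMn => x Mx; have [|y My yx] := MMp (quot_pi x); first by exists x.
(* The difference [x - y] is in the kernel [B], which every term of the chain contains. *)
rewrite -[x](subrK y); apply: ideal_add => //.
have /(chain_mono MP (leq0n i)) Mi := ltnW ip.
by apply/Mi/BM/quot_piE.
Qed.

End QuotientLength.

(** * Units of a local ring and its infinite residue field *)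

Section LocalRing.
Variables (R : comNzRingType) (m : ideal R).
Hypothesis R_local : local_ring m.
Implicit Types a b : R.

Definition invertible (a : R) := exists b : R, a * b = 1.

Lemma invertibleM a b : invertible a -> invertible b -> invertible (a * b).
Proof. by move=> [c ac] [d bd]; exists (c * d); rewrite mulrACA ac bd mulr1. Qed.

Lemma invertible_prod (T : Type) (r : seq T) (P : pred T) (F : T -> R) :
  (forall i, P i -> invertible (F i)) -> invertible (\prod_(i <- r | P i) F i).
Proof.
move=> FU; apply: big_ind => //; last exact: invertibleM.
by exists 1; rewrite mulr1.
Qed.

Lemma exists_maximal_ideal (A : ideal R) : ~ A 1 ->
  exists2 M : ideal R, maximal_ideal M & A `<=` M.
Proof.
move=> A1; pose P (X : set R) := X = set0 \/
  exists K : ideal R, [/\ K = X :> set R, ~ K 1 & A `<=` K].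
have [F FP Ftot|X [PX Xmax]] := @Zorn_bigcup _ P.
  have [F0|/existsNP[Y]] := pselect (forall Y, F Y -> Y = set0).
    by left; apply: bigcup0.
  move=> /not_implyP[FY Y0].
  have Fideal Z z : F Z -> Z z -> exists K : ideal R,
      [/\ K = Z :> set R, ~ K 1 & A `<=` K].
    by move=> FZ Zz; case: (FP _ FZ) => // Z0; rewrite Z0 in Zz.
  have [y0 Yy0] : Y !=set0 by apply/set0P/eqP.
  have [KY [KYE _ AKY]] := Fideal _ _ FY Yy0.
  have Uideal : @is_submodule R R^o (\bigcup_(Z in F) Z).
    apply: is_ideal; first by exists Y => //; rewrite -KYE; exact: ideal_zero.
      move=> x y [Z FZ Zx] [W FW Wy].
      have [K [KE _ _]] := Fideal _ _ FZ Zx; have [L [LE _ _]] := Fideal _ _ FW Wy.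
      have [ZW|WZ] := Ftot _ _ FZ FW.
        by exists W => //; rewrite -LE; apply: ideal_add; rewrite LE //; exact: ZW.
      by exists Z => //; rewrite -KE; apply: ideal_add; rewrite KE //; exact: WZ.
    move=> a x [Z FZ Zx]; have [K [KE _ _]] := Fideal _ _ FZ Zx.
    by exists Z => //; rewrite -KE; apply: ideal_mulr; rewrite KE.
  right; exists (Submodule Uideal); split=> //= [[Z FZ Z1]|x Ax].
    by have [K [KE K1 _]] := Fideal _ _ FZ Z1; apply: K1; rewrite KE.
  by exists Y => //; rewrite -KYE; exact: AKY.
have PA : P A by right; exists A; split.
case: PX => [X0|[M [ME M1 AM]]].
  exfalso; apply: Xmax PA; rewrite X0; split=> // /(_ 0).
  by apply; exact: ideal_zero.
exists M => //; split=> // K K1 MK; apply/seteqP; split=> // x Kx.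
apply: contrapT => Mx; apply: (Xmax K); last by right; exists K; split=> // z /AM /MK.
by rewrite -ME; split=> // KM; apply: Mx; exact: KM.
Qed.

Lemma local_invertible a : ~ m a -> invertible a.
Proof.
move=> ma; apply: contrapT => aU.
have [[b _ ab]|M Mmax AM] := @exists_maximal_ideal (idealZ a (idealT R)).
  by apply: aU; exists b.
by apply: ma; rewrite -(R_local.2 _ Mmax); apply: AM; exists 1; rewrite ?mulr1.
Qed.

Lemma local_invertible1D a : m a -> exists b : R, (1 + a) * b = 1.
Proof.
move=> ma; apply: local_invertible => m1a; apply: R_local.1.1.
by have := ideal_sub m1a ma; rewrite addrK.
Qed.

(** Lifts of distinct residues: their differences avoid [m], so they are units, as Vandermonde
    determinants require. *)
Lemma residue_sequence : infinite_set [set: quotmod m] ->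
  exists t : nat -> R, forall i j, i <> j -> invertible (t i - t j).
Proof.
move=> /infiniteP/card_leP[f].
pose g (i : nat) : quotmod m := \val (f (exist _ i (mem_setT i))).
have g_inj : injective g.
  move=> i j /val_inj /(inj (in_setT _) (in_setT _)) ij.
  by have := congr1 val ij.
have /choice[t tP] (i : nat) : exists x : R, g i = quot_pi m x.
  exact: quot_pi_surj.
exists t => i j ij; apply: local_invertible => /quot_piE.
by rewrite -!tP => /g_inj.
Qed.

(** The Vandermonde determinant is a product of units, so the adjugate recovers each [c i] as a
    combination of the given sums. *)
Lemma vandermonde_mem (U : ideal R) n (t c : 'I_n -> R) :
  (forall i j, i != j -> invertible (t i - t j)) ->
  (forall j, U (\sum_(i < n) t j ^+ i * c i)) -> forall i, U (c i).
Proof.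
move=> tU Utc i; pose V := Vandermonde n (\row_j t j).
have [b detVb] : invertible (\det V).
  rewrite det_Vandermonde; apply: invertible_prod => k _.
  apply: invertible_prod => j kj; rewrite !mxE; apply: tU.
  by rewrite eq_sym neq_ltn kj.
pose r := \row_j c j; suff : U ((r *m V *m \adj V) 0 i).
  rewrite -mulmxA mul_mx_adj mul_mx_scalar !mxE => Ud.
  by rewrite -[c i]mul1r -detVb mulrAC; apply: ideal_mull.
rewrite mxE; apply: ideal_sum => j _; apply: ideal_mull.
rewrite mxE (_ : \sum_k _ = \sum_(l < n) t j ^+ l * c l) //.
by apply: eq_bigr => k _; rewrite !mxE mulrC.
Qed.

End LocalRing.

(** * Generic elements and the Eakin-Sathaye induction *)

Section GenericReduction.
Variables (R : comNzRingType) (g : seq R) (t : nat -> R).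
Hypothesis tU : forall i j, i <> j -> invertible (t i - t j).
Implicit Types A B : nat -> ideal R.

(** The coefficient vectors lie on the moment curve, so those of any [size g] distinct parameters
    form an invertible Vandermonde matrix. *)
Definition moment_comb p : R := \sum_(i < size g) t p ^+ i * g`_i.

Local Notation ell := moment_comb.

(* [A j / B j] plays the role of the degree [j] part of a graded module over
   the polynomial ring in the elements of [g], generated in degree [0]. *)
Definition graded_quotient A B :=
  [/\ forall j, B j `<=` A j,
      forall j (x y : R), x \in g -> A j y -> A j.+1 (x * y),
      forall j (x y : R), x \in g -> B j y -> B j.+1 (x * y) &
      forall j (C : ideal R), B j.+1 `<=` C ->
        (forall x y : R, x \in g -> A j y -> C (x * y)) -> A j.+1 `<=` C].

Lemma moment_comb_mem (A C : ideal R) p :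
  (forall x y : R, x \in g -> A y -> C (x * y)) ->
  forall y : R, A y -> C (ell p * y).
Proof.
move=> AC y Ay; rewrite big_distrl; apply: ideal_sum => i _ /=.
by rewrite -mulrA; apply: ideal_mulr; apply: AC => //; exact: mem_nth.
Qed.

Lemma ideal_moment_span (A U : ideal R) (f : nat -> nat) : injective f ->
  (forall i (y : R), A y -> U (ell (f i) * y)) ->
  forall x y : R, x \in g -> A y -> U (x * y).
Proof.
move=> f_inj AU x y xg Ay.
have ix : (index x g < size g)%N by rewrite index_mem.
have := @vandermonde_mem _ U (size g) (fun i => t (f i)) (fun i => g`_i * y).
move=> /(_ _ _ (Ordinal ix)) /=; rewrite nth_index //; apply.
  by move=> i j ij; apply: tU => /f_inj /ord_inj /eqP; rewrite (negbTE ij).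
move=> j; have := AU j y Ay; rewrite big_distrl /=.
by under eq_bigr do rewrite -mulrA.
Qed.

Lemma infinitely_often (P : nat -> Prop) :
  (forall N, exists2 p, (N <= p)%N & P p) ->
  forall N, exists f : nat -> nat,
    [/\ injective f, forall i, (N <= f i)%N & forall i, P (f i)].
Proof.
move=> Pinf N; have /choice[h hP] (n : nat) : exists p, (n <= p)%N /\ P p.
  by have [p] := Pinf n; exists p.
pose f i := iter i (fun p => h p.+1) (h N).
have f_incr i : (f i < f i.+1)%N by have [] := hP (f i).+1.
have f_mono : {mono f : i j / (i <= j)%N} 
  by apply: leq_mono; apply: (homo_ltn (@ltn_trans)).
exists f; split=> [i j fij|i|[|i]]; last 2 first.
- by case: (hP N).
- by case: (hP (f i).+1).
- by apply/eqP; rewrite eqn_leq -(f_mono i) -(f_mono j) fij leqnn.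
- by have [Nh _] := hP N; apply: leq_trans Nh _; rewrite (f_mono 0%N i).
Qed.

(* Eakin-Sathaye for a principal reduction. Take a bad parameter [p0] with
   [ell p0 * A n] as long as possible; induction for the shifted module
   [ell p0 * A] gives [ell p0 * A n <= ell p * A n] for almost all [p], with
   equality at the bad ones, and the [ell p] span [g]. *)
Lemma generic_reduction n A B : graded_quotient A B ->
  ~ has_chain (B n) (A n) n.+1 ->
  exists N, forall p, (N <= p)%N ->
    A n `<=` if n is n'.+1 then idealD (idealZ (ell p) (A n')) (B n) : set R
             else B n.
Proof.
elim: n A B => [|n IH] A B [BA AS BS Agen] Anchain.
  exists 0%N => p _; apply: contrapT => AB; apply: Anchain.
  by apply: has_chain1; split.
pose D p := idealD (idealZ (ell p) (A n)) (B n.+1).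
pose bad p := ~ A n.+1 `<=` D p.
have BD p : B n.+1 `<=` D p by exact: idealDr.
have DA p : D p `<=` A n.+1.
  apply: idealD_sub (BA _) => _ [y Ay ->].
  by apply: moment_comb_mem Ay => x z; exact: AS.
apply: contrapT => /forallNP badinf.
have {}badinf N : exists2 p, (N <= p)%N & bad p.
  by have /existsNP[p /not_implyP[Np badp]] := badinf N; exists p.
pose Q d := `[< exists2 p, bad p & has_chain (B n.+1) (D p) d >].
have Q0 : exists d, Q d.
  have [p _ badp] := badinf 0%N; exists 0%N; apply/asboolP; exists p => //.
  exact: has_chain0.
(* Badness supplies one more strict step, from [D p] up to [A n.+1], so [n.+1] steps below [D p]
   would make the forbidden [n.+2]. *)
have bad_chain p d : bad p -> has_chain (B n.+1) (D p) d -> (d < n.+1)%N.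
  move=> badp Dd; rewrite ltnNge; apply/negP => nd; apply: Anchain.
  by apply: (has_chain_le (n := d.+1)) => //; apply: has_chainS Dd _; split.
have Qle d : Q d -> (d <= n.+1)%N.
  by move=> /asboolP[p badp /(bad_chain _ _ badp)/ltnW].
case: (ex_maxnP Q0 Qle) => d /asboolP[p0 bad0 D0] dmax.
have dn := bad_chain _ _ bad0 D0.
(* Shifting the degree by one makes [A' n] equal to [D p0], and [bad_chain] is then the hypothesis
   of the induction in degree [n]. *)
pose A' j := idealD (idealZ (ell p0) (A j)) (B j.+1); pose B' j := B j.+1.
have [||N ND] := IH A' B'.
- split=> [j|j x y xg|j x y xg|j C BC A'C].
  + exact: idealDr.
  + case=> _ [z [[u Au ->] Bz ->]]; rewrite mulrDr mulrCA.
    exists (ell p0 * (x * u)), (x * z); split=> //; last exact: BS.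
    by exists (x * u) => //; exact: AS.
  + exact: BS.
  + apply: idealD_sub (BC) => _ [u Au ->].
    (* Generation of [A] is inherited by [ell p0 * A] on passing from [C] to its colon by
       [ell p0]. *)
    have /(_ u Au) : A j.+1 `<=` colon C [set ell p0].
      apply: Agen => [y By s -> |x y xg Ay s ->].
        rewrite mulrC; apply: (moment_comb_mem (A := B j.+1)) By => x z xg Bz.
        exact/BC/BS.
      rewrite -mulrA; apply: A'C => //; apply: idealDl.
      by exists y; rewrite // mulrC.
    by move=> /(_ _ erefl); rewrite mulrC.
- by move=> /(bad_chain _ _ bad0); rewrite ltnn.
have D0D p : (N <= p)%N -> D p0 `<=` D p.
  move=> /ND /subset_trans; apply; rewrite /D /A' /B'.
  case: (n) => [|n']; first exact: idealDr.
  apply: idealD_sub; last exact: idealDr.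
  move=> _ [_ [_ [v [[u Au ->] Bv ->]]] ->]; rewrite mulrDr.
  apply: ideal_add; last by apply/idealDr/moment_comb_mem/Bv => x y; exact: BS.
  apply: idealDl; exists (ell p0 * u) => //.
  by apply: moment_comb_mem Au => x y; exact: AS.
have [f [f_inj Nf badf]] := infinitely_often badinf N.
apply: bad0; apply: Agen => //.
apply: (ideal_moment_span f_inj) => i y Ay.
have : D (f i) `<=` D p0.
  apply: contrapT => DD; suff: (d < d)%N by rewrite ltnn.
  apply: dmax; apply/asboolP; exists (f i) => //.
  by apply: has_chainS D0 _; split=> //; exact: D0D.
by move=> DD; apply/DD/idealDl; exists y.
Qed.

End GenericReduction.

(** * Powers of I: reductions, multiplicity and integral closure *)

Section HilbertFunction.
Variables (R : comNzRingType) (m I : ideal R).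
Hypotheses (R_noeth : noetherian R) (R_local : local_ring m).
Implicit Types (A B C J K L M : ideal R) (a b l x y : R).

(** The generic reduction is applied to the fiber pieces I^j / m I^j, and Nakayama removes the error
    term m I^n. Degree 0 is excluded, since there it would put 1 in [m]. *)
Lemma eakin_sathaye n : infinite_set [set: quotmod m] ->
  ~ has_chain (ideal_mul m (ideal_exp I n)) (ideal_exp I n) n.+1 ->
  exists l n', [/\ n = n'.+1, I l &
    ideal_exp I n `<=` idealZ l (ideal_exp I n')].
Proof.
move=> /(residue_sequence R_local)[t tU] nchain; have [g Ig] := R_noeth I.
have gI x : x \in g -> I x by rewrite Ig => xg; exact: ideal_gen_mem.
have [||N ND] := @generic_reduction R g t tU n (ideal_exp I)
    (fun j => ideal_mul m (ideal_exp I j)).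
- split=> [j|j x y /gI Ix Iy|j x y /gI Ix my|j C mC gC].
  + exact: ideal_mul_subr.
  + exact: ideal_mul_mem.
  + suff : ideal_mul m (ideal_exp I j) `<=`
        colon (ideal_mul m (ideal_exp I j.+1)) [set x].
      by move=> /(_ y my) /(_ x erefl); rewrite mulrC.
    apply: ideal_mul_sub => a b ma Ib s ->; rewrite -mulrA [b * x]mulrC.
    by apply: ideal_mul_mem => //; exact: ideal_mul_mem.
  + apply: ideal_mul_sub => a b Ia Ib; suff /(_ a) : I `<=` colon C [set b].
      by apply.
    by rewrite Ig; apply: ideal_gen_sub => x xg _ ->; exact: gC.
- exact: nchain.
case: n ND {nchain} => [|n] ND.
  case: R_local.1.1; apply: (@ideal_mul_subl _ m (ideal_exp I 0)).
  by apply: (ND N) => //; exact: ideal_exp0.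
exists (moment_comb g t N), n; split=> //.
  by apply: ideal_sum => i _; apply/ideal_mulr/gI/mem_nth.
apply: (nakayama (m := m)) => //; first exact: local_invertible1D.
exact: ND.
Qed.

Lemma ideal_expZ_le l i j : I l -> (i <= j)%N ->
  ideal_exp I i.+1 `<=` idealZ l (ideal_exp I i) ->
  ideal_exp I j.+1 `<=` idealZ l (ideal_exp I j).
Proof.
move=> Il /subnK <- Ii; elim: (j - i)%N => [//|d IH].
apply: ideal_mul_sub => a b Ia /IH[c Ic ->]; rewrite mulrCA.
by exists (a * c) => //; exact: ideal_mul_mem.
Qed.

(** Multiplication by [l] maps I^d / I^(d+1) onto I^(d+1) / I^(d+2) for d >= i, and chains pull back
    along a surjection. *)
Lemma has_chain_exp_le l i j n : I l -> (i <= j)%N ->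
  ideal_exp I i.+1 `<=` idealZ l (ideal_exp I i) ->
  has_chain (ideal_exp I j.+1) (ideal_exp I j) n ->
  has_chain (ideal_exp I i.+1) (ideal_exp I i) n.
Proof.
move=> Il /subnK <- Ii; elim: (j - i)%N => [//|d IH] [N [IN NP NI]]; apply: IH.
have Id := ideal_expZ_le Il (leq_addl d i) Ii.
pose P p := idealI (ideal_exp I (d + i)) (colon (N p) [set l]).
exists P; split=> [x Ix|p pn|x []//].
  split=> [|_ ->]; first exact: ideal_exp_decr.
  by apply: IN; rewrite mulrC; exact: ideal_mul_mem.
have [NN NNn] := NP p pn; split=> [x [Ix Nx]|PP].
  by split=> // s sl; exact/NN/Nx.
apply: NNn => z Nz; have [y Iy zE] := Id z (NI _ (chain_mono NP pn (leqnn n) Nz)).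
have [|_ /(_ _ erefl)] := PP y; last by rewrite zE mulrC.
by split=> // _ ->; rewrite mulrC -zE.
Qed.

(** A longest chain above I^(j+2) is split at I^(j+1): at most the length of R / I^(j+1) lies above,
    so at least the difference of the two lengths, which is [e0], lies below. *)
Lemma hilbert_function_multiplicity e0 e1 i : hilbert_coeffs I e0 e1 ->
  exists j c, [/\ (i <= j)%N, e0 <= c%:Z &
    has_chain (ideal_exp I j.+1) (ideal_exp I j) c].
Proof.
move=> [N NP]; pose j := (N + i)%N.
have [l /has_length_chain[_ lmax] lE] := NP j (leq_addr _ _).
have [l' /has_length_chain[l'chain _] l'E] := NP j.+1 (leqW (leq_addr _ _)).
have [//|p [q [pq Ip Iq]]] := has_chain_split (@ideal_exp_decr _ I j.+1) _ l'chain.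
exists j.+1, p; split=> //; first by rewrite /j; lia.
have ql := lmax q Iq; move: lE l'E; rewrite pq -addn1 !PoszD mulrDr mulr1.
lia.
Qed.

(** Were the products equal, [y * M] would lie in [K * M], and the determinant trick would make [y]
    integral over [K]. *)
Lemma ideal_mul_strict K L M x y : M x -> (forall a : R, a * x = 0 -> a = 0) ->
  K `<=` L -> L y -> ~ integral_closure K y -> ideal_mul K M `<` ideal_mul L M.
Proof.
move=> Mx xreg KL Ly Ky; split; first exact: ideal_mulS.
move=> LK; apply: Ky; apply: (integral_of_mul R_noeth Mx xreg) => z Mz.
exact/LK/ideal_mul_mem.
Qed.

Lemma integral_closure_sub : I `<=` integral_closure I.
Proof.
move=> x Ix; exists 1%N, (fun=> - x); split=> // [i|].
  rewrite -eqn_leq => /eqP <-; apply: ideal_opp.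
  by rewrite -[x]mulr1; apply: ideal_mul_mem => //; exact: ideal_exp0.
by rewrite big_nat1 subnn expr0 expr1 mulr1 subrr.
Qed.

(* An equation of integral dependence of [a] over [I] makes [I] a reduction of
   [I + (a)]. *)
Lemma integral_closure_adjoin a x : integral_closure I a -> I x ->
  (forall b : R, b * x = 0 -> b = 0) ->
  idealD I (idealZ a (idealT R)) `<=` integral_closure I.
Proof.
move=> [n [c [n_gt0 Ic ac]]] Ix xreg y Ky.
set K := idealD _ _ in Ky.
have IK : I `<=` K by exact: idealDl.
have Ka : K a by apply: idealDr; exists 1; rewrite ?mulr1.
(* In the expansion of a power of I + (a), only the pure power of [a] has no factor from [I]. *)
have KD j : ideal_exp K j.+1 `<=`
    idealD (ideal_mul I (ideal_exp K j)) (idealZ (a ^+ j.+1) (idealT R)).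
  elim: j => [|j IH].
    apply: ideal_mul_sub => _ v [z [_ [Iz [w _ ->] ->]]] Kv.
    rewrite mulrDl expr1; exists (z * v), (a * w * v); split=> //.
      exact: ideal_mul_mem.
    by exists (w * v); rewrite ?mulrA.
  apply: ideal_mul_sub => _ v [z [_ [Iz [w _ ->] ->]]] Kv; rewrite mulrDl.
  apply: ideal_add; first by apply/idealDl/ideal_mul_mem.
  have [u [_ [IKu [s _ ->] ->]]] := IH v Kv; rewrite mulrDr; apply: ideal_add.
    apply: idealDl; have : ideal_mul I (ideal_exp K j) `<=`
        colon (ideal_mul I (ideal_exp K j.+1)) [set a * w].
      apply: ideal_mul_sub => b d Ib Kd _ ->; rewrite -mulrA.
      apply: ideal_mul_mem => //; rewrite mulrC; apply: ideal_mul_mem => //.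
      exact: ideal_mull.
    by move=> /(_ u IKu _ erefl); rewrite mulrC.
  by apply: idealDr; exists (w * s) => //; rewrite [a ^+ j.+2]exprS mulrACA.
have IKan : ideal_mul I (ideal_exp K n.-1) (a ^+ n).
  move/eqP: ac; rewrite addr_eq0 => /eqP ->; apply: ideal_opp.
  rewrite big_add1 big_mkord; apply: ideal_sum => i _.
  have Ici : ideal_exp I i.+1 (c i.+1) by apply: Ic; exact: ltn_ord.
  suff : ideal_exp I i.+1 `<=`
      colon (ideal_mul I (ideal_exp K n.-1)) [set a ^+ (n - i.+1)].
    by move=> /(_ _ Ici); apply.
  apply: ideal_mul_sub => b d Ib Id _ ->; rewrite -mulrA.
  apply: ideal_mul_mem => //.
  (* The term c_(i+1) a^(n-i-1) has total degree n, and one factor of c_(i+1) is kept in [I]. *)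
  have -> : n.-1 = (i + (n - i.+1))%N by have := ltn_ord i; lia.
  by apply: ideal_exp_mul; [exact: ideal_expS Id|exact: ideal_exp_pow].
have KI : ideal_exp K n `<=` ideal_mul I (ideal_exp K n.-1).
  case: n n_gt0 IKan {Ic ac} => // n _ IKan; apply: subset_trans (KD n) _.
  apply: idealD_sub => // _ [z _ ->]; exact: ideal_mull.
(* The test module is K^(n-1), which contains the nonzerodivisor x^(n-1); multiplication by [y]
   takes it into K^n, hence into I K^(n-1). *)
apply: (integral_of_mul R_noeth (ideal_exp_pow n.-1 (IK _ Ix))).
  exact: regular_exp.
move=> z Kz; apply: KI; case: n n_gt0 Kz {Ic ac IKan} => // n _ Kz.
exact: ideal_mul_mem.
Qed.

End HilbertFunction.

(** * Regular elements, summation of the bounds and the theorem *)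

Lemma exists_regular_element (R : comNzRingType) (m I : ideal R) :
  cohen_macaulay m -> krull_dim R 1 -> primary_to m I ->
  exists2 x : R, I x & forall a : R, a * x = 0 -> a = 0.
Proof.
move=> [d [dchain dmax] [[s [sm sreg] sd] _]] [c1 max1] [_ Im].
(* Depth equals dimension, here one, so a maximal regular sequence starts with a nonzerodivisor of
   [m]; a power of it lies in [I]. *)
have d1 : d = 1%N by apply/eqP; rewrite eqn_leq (max1 _ dchain) (dmax _ c1).
case: s sd sm sreg => [|x s] sd sm sreg; first by rewrite d1 in sd.
have xreg a : a * x = 0 -> a = 0.
  move=> ax; have := sreg 0%N isT a; rewrite take0 /= ax => O0.
  have [b _ ->] : idealZ 0 (idealT R) a; last by rewrite mul0r.
  by apply: O0 => [J _|z //]; exact: ideal_zero.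
have [n In] : radical I x by rewrite Im; apply: sm; rewrite mem_head.
by exists (x ^+ n) => //; exact: regular_exp.
Qed.

(** The positive terms are among z - 1, z - 2, ..., 1. The induction removes the first one by the
    Pascal rule; for z <= 0 the sum is 0 and [binz2 z] is nonnegative. *)
Lemma sum_max_le_binz2 (z : int) n :
  \sum_(i < n) Num.max 0 (z - 1 - i%:Z) <= binz2 z.
Proof.
have binzE (w : int) : binz2 w * 2%:Z = w * (w - 1).
  apply: divzK; have [q [wq|wq]] : exists q, w = q * 2%:Z \/ w = q * 2%:Z + 1.
  - by exists (w %/ 2)%Z; lia.
  - by apply/dvdzP; exists (q * (w - 1)); rewrite {1}wq mulrAC.
  - by apply/dvdzP; exists (w * q); rewrite {2}wq addrK mulrA.
elim: n z => [|n IH] z; first by rewrite big_ord0; have := binzE z; nia.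
have [z0|z0] := lerP z 0.
  by rewrite big1 => [|i _]; [have := binzE z; nia|lia].
rewrite big_ord_recl subr0; have := IH (z - 1).
have -> : \sum_(i < n) Num.max 0 (z - 1 - (lift ord0 i)%:Z) =
    \sum_(i < n) Num.max 0 (z - 1 - 1 - i%:Z) :> int.
  by apply: eq_bigr => i _; rewrite lift0; congr Num.max; lia.
by have := binzE z; have := binzE (z - 1); lia.
Qed.

Lemma has_chain_exp_sum (R : comNzRingType) (I : ideal R) (h : nat -> nat) n :
  (forall i, has_chain (ideal_exp I i.+1) (ideal_exp I i) (h i)) ->
  has_chain (ideal_exp I n) (idealT R) (\sum_(i < n) h i)%N.
Proof.
move=> hI; elim: n => [|n IH]; first by rewrite big_ord0; exact: has_chain0.
by rewrite big_ord_recr [X in has_chain _ _ X]addnC; apply: has_chain_cat IH.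
Qed.

(** The slack [d] is the extra length found in degree 0: it is 0 for the general bound and 1 for the
    strict one. *)
Lemma hilbert_coeff1_bound (R : comNzRingType) (I : ideal R) (e0 e1 : int)
    (k d : nat) : hilbert_coeffs I e0 e1 ->
  (forall i, exists2 c : nat,
     has_chain (ideal_exp I i.+1) (ideal_exp I i) c &
     e0 <= c%:Z \/ (i + k.+1 <= c)%N) ->
  has_chain (ideal_exp I 1) (ideal_exp I 0) (k.+1 + d) ->
  e1 + d%:Z <= binz2 (e0 - k%:Z).
Proof.
move=> [N NP] hI h0.
have /choice[h hP] (i : nat) : exists c : nat,
    [/\ has_chain (ideal_exp I i.+1) (ideal_exp I i) c,
        e0 <= c%:Z \/ (i + k.+1 <= c)%N & i = 0%N -> (k.+1 + d <= c)%N].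
  case: i => [|i]; first by exists (k.+1 + d)%N; split=> //; right; lia.
  by have [c ? ?] := hI i.+1; exists c.
have [l /has_length_chain[_ lmax] lE] := NP N (leqnn N).
have hl : (\sum_(i < N.+1) h i <= l)%N.
  by apply/lmax/has_chain_exp_sum => i; case: (hP i).
apply: le_trans (sum_max_le_binz2 _ N.+1).
have e1E : e1 = e0 * N.+1%:Z - l%:Z by rewrite lE; ring.
have sumE : \sum_(i < N.+1) (e0 - (h i)%:Z) =
    e0 * N.+1%:Z - (\sum_(i < N.+1) h i)%N%:Z.
  by rewrite sumrB sumr_const card_ord -mulr_natr natz -(big_morph Posz PoszD erefl).
apply: (@le_trans _ _ (\sum_(i < N.+1) (e0 - (h i)%:Z) + d%:Z)).
  by rewrite sumE e1E lerD2r lerD2l lerN2 lez_nat.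
rewrite !big_ord_recl addrAC; apply: lerD.
  by have [_ _ /(_ erefl) h0d] := hP 0%N; rewrite /=; lia.
apply: ler_sum => i _; have [_ hi _] := hP (lift ord0 i).
by case: hi; rewrite lift0; lia.
Qed.

(** One indexing from [I] to [m] covers k = 1 and k > 1 alike. Distinctness makes the inner
    inclusions strict, and stating strictness over the integral closure provides the nonintegral
    elements that [ideal_mul_strict] needs. *)
Lemma integrally_closed_chain (R : comNzRingType) (m I : ideal R) (k : nat)
    (J : nat -> ideal R) :
  (1 <= k)%N ->
  (forall i, (1 <= i < k)%N -> integrally_closed (J i)) ->
  (forall i j, (1 <= i < k)%N -> (1 <= j < k)%N -> i <> j ->
     J i <> J j :> set R) ->
  (if k == 1%N then integral_closure I `<` m else
     [/\ J k.-1 `<` m,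
         forall i, (1 <= i)%N -> (i.+1 < k)%N -> J i `<=` J i.+1 &
         integral_closure I `<` J 1%N]) ->
  exists F : nat -> ideal R, [/\ F 0%N = I, F k = m &
    forall i, (i < k)%N -> integral_closure (F i) `<` F i.+1].
Proof.
move=> k_gt0 Jclosed Jdist Jchain.
exists (fun i => if i == 0%N then I else if i == k then m else J i).
split=> [//||i ik]; first by rewrite eqxx; case: k k_gt0 {Jclosed Jdist Jchain}.
rewrite (ltn_eqF ik); case: eqP Jchain => [k1|k1 [Jm Jincr IJ]].
  by move: ik; rewrite k1 ltnS leqn0 => /eqP ->.
case: i ik => [|i] ik; first by rewrite ifN // eq_sym; apply/eqP.
change (integral_closure (J i.+1) `<` (if i.+2 == k then m else J i.+2)).
rewrite (Jclosed i.+1 ik).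
case: eqP => [ik'|/eqP ik']; first by move: Jm; rewrite -ik'.
have {}ik' : (i.+2 < k)%N by rewrite ltn_neqAle ik'.
split; first exact: Jincr.
move=> JJ; apply: (Jdist i.+1 i.+2 ik ik'); first by lia.
by apply/seteqP; split=> //; exact: Jincr.
Qed.

Lemma has_chain_mul (R : comNzRingType) (M : ideal R) (F : nat -> ideal R) k x :
  noetherian R -> M x -> (forall a : R, a * x = 0 -> a = 0) ->
  (forall i, (i < k)%N -> integral_closure (F i) `<` F i.+1) ->
  has_chain (ideal_mul (F 0%N) M) (ideal_mul (F k) M) k.
Proof.
move=> noeth Mx xreg FP; exists (fun i => ideal_mul (F i) M).
split=> // i /FP[FF FFn].
have [y Fy Fyn] : exists2 y, F i.+1 y & ~ integral_closure (F i) y.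
  apply: contrapT => nex; apply: FFn => y Fy; apply: contrapT => Fyn.
  by apply: nex; exists y.
apply: (ideal_mul_strict noeth Mx xreg) Fy Fyn.
by apply: subset_trans FF; exact: integral_closure_sub.
Qed.

Theorem theorem2p1 (R : comNzRingType) (m I : ideal R) (k : nat)
    (J : nat -> ideal R) (e0 e1 : int)
    (R_noeth : noetherian R)
    (R_local : local_ring m)
    (R_cm : cohen_macaulay m)
    (R_dim1 : krull_dim R 1)
    (res_inf : infinite_set [set: quotmod m])
    (I_primary : primary_to m I)
    (e_coeffs : hilbert_coeffs I e0 e1)
    (k_ge1 : (1 <= k)%N)
    (J_closed : forall i, (1 <= i < k)%N -> integrally_closed (J i))
    (J_distinct : forall i j, (1 <= i < k)%N -> (1 <= j < k)%N -> i <> j ->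
       J i <> J j :> set R)
    (J_chain : if k == 1%N then integral_closure I `<` m else
       [/\ J k.-1 `<` m,
           forall i, (1 <= i)%N -> (i.+1 < k)%N -> J i `<=` J i.+1 &
           integral_closure I `<` J 1%N]) :
  e1 <= binz2 (e0 - k%:Z) /\
  (~ integrally_closed I -> e1 < binz2 (e0 - k%:Z)).
Proof.
have [x Ix xreg] := exists_regular_element R_cm R_dim1 I_primary.
have [F [F0 Fk FP]] := integrally_closed_chain k_ge1 J_closed J_distinct J_chain.
have chain_mI i : has_chain (ideal_exp I i.+1) (ideal_mul m (ideal_exp I i)) k.
  have := has_chain_mul R_noeth (ideal_exp_pow i Ix) (regular_exp xreg) FP.
  by rewrite F0 Fk.
have hI i : exists2 c : nat,
    has_chain (ideal_exp I i.+1) (ideal_exp I i) c &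
    e0 <= c%:Z \/ (i + k.+1 <= c)%N.
  have [mI|/(eakin_sathaye R_noeth R_local res_inf)[l [i' [-> Il li']]]] :=
      pselect (has_chain (ideal_mul m (ideal_exp I i)) (ideal_exp I i) i.+1).
    by exists (k + i.+1)%N; [exact: has_chain_cat mI|right; lia].
  (* The bound [e0] is known only in some high degree [j]; the reduction by [l] carries it down to
     degree [i'.+1]. *)
  have [j [c [ij e0c cj]]] := hilbert_function_multiplicity i'.+1 e_coeffs.
  exists c; last by left.
  exact: has_chain_exp_le Il ij (ideal_expZ_le Il (leqnSn i') li') cj.
have mT : ideal_mul m (ideal_exp I 0) `<` ideal_exp I 0.
  split=> [|mI]; first exact: ideal_mul_subr.
  apply: R_local.1.1; apply: (@ideal_mul_subl _ m (ideal_exp I 0)).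
  exact/mI/ideal_exp0.
split=> [|Iclosed].
  have := @hilbert_coeff1_bound _ _ _ _ k 0 e_coeffs hI; rewrite addr0; apply.
  by rewrite addn0; apply: has_chainS mT.
have := @hilbert_coeff1_bound _ _ _ _ k 1 e_coeffs hI.
suff h0 : has_chain (ideal_exp I 1) (ideal_exp I 0) (k.+1 + 1) by move=> /(_ h0); lia.
have [a Ia Ian] : exists2 a, integral_closure I a & ~ I a.
  apply: contrapT => nex; apply: Iclosed; apply/seteqP; split=> [a Ia|].
    by apply: contrapT => Ian; apply: nex; exists a.
  exact: integral_closure_sub.
(* The ideal [K] is an additional term: I < K < F 1 < ... < F k = m < R has k + 2 strict steps. *)
pose K := idealD I (idealZ a (idealT R)).
have KI := integral_closure_adjoin R_noeth Ia Ix xreg.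
have [IF1 F1I] := FP 0%N k_ge1; rewrite F0 in IF1 F1I.
have IK : I `<` K.
  split=> [|KsubI]; first exact: idealDl.
  by apply: Ian; apply/KsubI/idealDr; exists 1; rewrite ?mulr1.
have KF1 : K `<` F 1%N.
  by split; [exact: subset_trans KI IF1|move/subset_trans/(_ KI)].
have F1F p : (p < k)%N -> has_chain (F 1%N) (F p.+1) p.
  elim: p => [_|p IH pk]; first exact: has_chain0.
  apply: has_chainS (IH (ltnW pk)) _; have [FF FFn] := FP p.+1 pk; split=> [y Fy|FF'].
    exact/FF/integral_closure_sub.
  by apply: FFn => y /FF' ?; exact: integral_closure_sub.
have Im : has_chain I m k.+1.
  have := has_chain_cat (has_chainS (has_chain1 IK) KF1) (F1F k.-1 _).
  by rewrite !prednK // Fk addSn add1n prednK //; apply.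
rewrite addn1; apply: (has_chainS (A := m)).
  by apply: has_chainW Im => //; exact: ideal_mul_subl.
split=> [y _|m1]; first exact: ideal_exp0.
by apply: R_local.1.1; apply/m1/ideal_exp0.
Qed.
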